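(* For every integer $k \geq 2$ there exists a set $T \subset \mathbb{R}^2$ such that: (1) for any $2k+3$ points of $T$ there is a point $x \in T$ that sees each of them through $T$; and (2) there exist $2k+4$ points of $T$ that are not all seen through $T$ from any single point of $T$.
   Context: For a set $S \subset \mathbb{R}^2$ and points $x,y \in S$, ''$x$ sees $y$ through $S$'' means that the closed segment $[x,y]$ is contained in $S$. *)

(* Defs.v *)
From Stdlib Require Import Reals.
Open Scope R_scope.

Definition point : Type := (R * R)%type.

Definition in_segment (x y z : point) : Prop :=
  exists t : R, 0 <= t <= 1 /\
    z = ((1 - t) * fst x + t * fst y, (1 - t) * snd x + t * snd y).

Definition sees_through (S : point -> Prop) (x y : point) : Prop :=
  S x /\ S y /\ forall z, in_segment x y z -> S z.

(* Main.v *)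
Require Import Defs.
From Stdlib Require Import Reals Lra Lia List Arith Cantor FinFun Classical.
From mathcomp Require classical_sets.
Open Scope R_scope.

(** Exhaust the reals by a chain of proper subfields [S_v].  To each [v] attach a
    class [c(v) < n], where [n = 2k + 4], a viewer [x_v] lying on no line through two points
    of [S_v^2], and a real [t_v] in [(0, 1)] outside [S_v(x_v)]; all of these data
    belong to the later fields, and every finite set of reals lies in some [S_v] of
    any prescribed class.  Let [T] be the least set containing the apexes
    [a_j = (j, 0)], [j < n], and every segment [[p, x_v]] with [p] in [T] and in
    [S_v^2], except for [p = a_c(v)].  Any [n - 1] points miss some apex [a_i], hence
    are all seen from any late enough viewer of class [i].  Conversely, if
    [[z, a_j]] lies in [T] with [z <> a_j], then choosing [S_v] with [z] in [S_v^2], the point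
    [(1 - t_v) z + t_v a_j] can only belong to [T] because [z] is on the line
    joining [a_j] to a viewer of class other than [j].  By genericity no point
    satisfies this for all [j].

    The chain of subfields comes from Zorn's lemma applied to the sets [A] such that
    countably many finitary operations on [A] do not produce all of [R]: a maximal one
    would contradict stability under adding a point, so some chain of them has a union
    that does generate [R].  Zorn's lemma again thins the chain so that the data
    attached to each field lie in the next ones. *)

(** * Uncountability of the reals *)

Definition bisect_step (c : R) (ab : R * R) : R * R :=
  let (a, b) := ab in
  if Rlt_dec c ((a + b) / 2) then ((a + 2 * b) / 3, b) else (a, (2 * a + b) / 3).

Fixpoint bisect (u : nat -> R) (n : nat) : R * R :=
  match n with
  | O => (0, 1)
  | S m => bisect_step (u m) (bisect u m)
  end.

Lemma bisect_step_spec c a b : a < b ->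
  let (a', b') := bisect_step c (a, b) in
  a <= a' /\ a' < b' /\ b' <= b /\ ~ (a' <= c <= b').
Proof. intros H; simpl; destruct (Rlt_dec _ _); lra. Qed.

Lemma bisect_nested u n m :
  fst (bisect u n) <= fst (bisect u (n + m)) /\
  fst (bisect u (n + m)) < snd (bisect u (n + m)) <= snd (bisect u n).
Proof.
induction m as [|m IH].
- rewrite Nat.add_0_r.
  enough (fst (bisect u n) < snd (bisect u n)) by lra.
  induction n as [|n IH]; simpl; [lra|].
  destruct (bisect u n) as [a b].
  pose proof (bisect_step_spec (u n) a b IH) as H.
  destruct (bisect_step (u n) (a, b)); simpl; tauto.
- rewrite Nat.add_succ_r; simpl.
  destruct (bisect u (n + m)) as [a b]; simpl in IH.
  pose proof (bisect_step_spec (u (n + m)%nat) a b (proj1 (proj2 IH))) as H.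
  destruct (bisect_step _ (a, b)); simpl; lra.
Qed.

(** Nested intervals: the supremum of the left ends lies in all of them, while the interval of index
    [S n] is an outer third chosen to exclude [u n]. *)
Lemma nat_not_onto_R (u : nat -> R) : exists r, forall n, u n <> r.
Proof.
assert (Hle : forall n m, fst (bisect u n) <= snd (bisect u m)).
{ intros n m. pose proof (bisect_nested u n m). pose proof (bisect_nested u m n).
  rewrite (Nat.add_comm m n) in *. lra. }
destruct (completeness (fun x => exists n, x = fst (bisect u n))) as [s [Hs1 Hs2]].
- exists 1; intros x [n ->]; exact (Hle n O).
- exists 0, O; reflexivity.
- exists s; intros n Hn.
  assert (Ha : fst (bisect u (S n)) <= s) by (apply Hs1; eauto).
  assert (Hb : s <= snd (bisect u (S n))) by (apply Hs2; intros x [k ->]; apply Hle).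
  pose proof (bisect_nested u n 0) as H; rewrite Nat.add_0_r in H.
  simpl in Ha, Hb; destruct (bisect u n) as [a b]; simpl in H.
  pose proof (bisect_step_spec (u n) a b (proj1 (proj2 H))) as H'.
  destruct (bisect_step (u n) (a, b)); simpl in *; lra.
Qed.

(** * Small sets of reals and a chain of them with large union *)

Inductive tree : Type :=
| Code : nat -> tree
| Var : R -> tree
| Node : tree -> tree -> tree.

Fixpoint tree_over (A : R -> Prop) (t : tree) : Prop :=
  match t with
  | Code _ => True
  | Var r => A r
  | Node l r => tree_over A l /\ tree_over A r
  end.

Lemma tree_over_sub (A B : R -> Prop) t :
  (forall r, A r -> B r) -> tree_over A t -> tree_over B t.
Proof. intros H; induction t; simpl; intuition. Qed.

(* Plays the role of "of cardinality less than the continuum": trees over [A] absorb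
   all the encodings that cardinal arithmetic would be needed for. *)
Definition small (A : R -> Prop) : Prop :=
  forall f : tree -> R, exists r, forall t, tree_over A t -> f t <> r.

Fixpoint decode_tree (fuel n : nat) : tree :=
  match fuel with
  | O => Code O
  | S k => match of_nat n with
           | (O, c) => Code c
           | (S _, c) => let (l, r) := of_nat c in Node (decode_tree k l) (decode_tree k r)
           end
  end.

(** Both subtrees of a node are decoded with the same fuel, so the induction needs every large
    enough fuel to work. *)
Lemma decode_tree_onto t :
  tree_over (fun _ => False) t ->
  exists k, forall k', (k <= k')%nat -> exists n, decode_tree k' n = t.
Proof.
induction t as [c|r|l IHl r IHr]; simpl; [intros _|tauto|].
- exists 1%nat; intros [|k'] Hk; [lia|].
  exists (to_nat (O, c)); cbn [decode_tree]; now rewrite cancel_of_to.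
- intros [Hl Hr]; destruct (IHl Hl) as [kl Kl], (IHr Hr) as [kr Kr].
  exists (S (kl + kr)); intros [|k'] Hk; [lia|].
  destruct (Kl k') as [nl <-]; [lia|]; destruct (Kr k') as [nr <-]; [lia|].
  exists (to_nat (1%nat, to_nat (nl, nr))); cbn [decode_tree].
  now rewrite !cancel_of_to.
Qed.

Lemma small_empty : small (fun _ => False).
Proof.
intros f.
destruct (nat_not_onto_R (fun n => let (k, c) := of_nat n in f (decode_tree k c))) as [r Hr].
exists r; intros t Ht E.
destruct (decode_tree_onto t Ht) as [k Hk]; destruct (Hk k (le_n k)) as [c Hc].
apply (Hr (to_nat (k, c))); rewrite cancel_of_to; now rewrite Hc.
Qed.

Lemma small_exists_notin A : small A -> exists r, ~ A r.
Proof.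
intros H; destruct (H (fun t => match t with Var r => r | _ => 0 end)) as [r Hr].
exists r; intros Ar; now apply (Hr (Var r)).
Qed.

(* Renumbering the codes frees [Code 0], which then stands for the new element [m]. *)
Fixpoint free_code (m : R) (t : tree) : tree :=
  match t with
  | Code O => Var m
  | Code (S c) => Code c
  | Var r => Var r
  | Node l r => Node (free_code m l) (free_code m r)
  end.

Lemma free_code_onto (A : R -> Prop) m t :
  tree_over (fun r => A r \/ r = m) t -> exists t', tree_over A t' /\ free_code m t' = t.
Proof.
induction t as [c|r|l IHl r IHr]; simpl.
- exists (Code (S c)); simpl; auto.
- intros [Hr| ->]; [exists (Var r)|exists (Code O)]; simpl; auto.
- intros [Hl Hr]; destruct (IHl Hl) as [l' [? <-]], (IHr Hr) as [r' [? <-]].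
  exists (Node l' r'); simpl; auto.
Qed.

Lemma small_add A m : small A -> small (fun r => A r \/ r = m).
Proof.
intros HA f; destruct (HA (fun t => f (free_code m t))) as [r Hr].
exists r; intros t Ht; destruct (free_code_onto A m t Ht) as [t' [Ht' <-]].
now apply Hr.
Qed.

Lemma exists_large_chain :
  exists F : (R -> Prop) -> Prop,
    (forall A, F A -> small A) /\
    (forall A B, F A -> F B -> (forall r, A r -> B r) \/ (forall r, B r -> A r)) /\
    exists f : tree -> R, forall r, exists A t, F A /\ tree_over A t /\ f t = r.
Proof.
apply NNPP; intros Hno.
destruct (@classical_sets.Zorn_bigcup R small) as [A [HA Amax]].
- intros F Fs Ftot.
  apply NNPP; intros Hbig; apply Hno.
  (* The empty set is adjoined so that trees without variables lie over some member even when [F] is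
     empty. *)
  exists (fun A => F A \/ A = (fun _ => False)).
  split; [|split].
  + intros A [HA| ->]; [now apply Fs|apply small_empty].
  + intros A B [HA| ->] [HB| ->]; [exact (Ftot A B HA HB)|right|left|left]; intros r [].
  + apply not_all_ex_not in Hbig; destruct Hbig as [f Hf].
    exists f; intros r.
    apply NNPP; intros Hr; apply Hf; exists r; intros t Ht E; apply Hr.
    (* A tree has finitely many leaves, so along a chain they all lie in one member. *)
    enough (exists A, (F A \/ A = (fun _ => False)) /\ tree_over A t)
      as [A [? ?]] by (exists A, t; auto).
    clear E; induction t as [c|x|t1 IH1 t2 IH2]; simpl in Ht.
    * exists (fun _ => False); simpl; auto.
    * destruct Ht as [A HA HAx]; exists A; simpl; auto.
    * destruct (IH1 (proj1 Ht)) as [A [[HA| ->] HA']], (IH2 (proj2 Ht)) as [B [[HB| ->] HB']];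
        simpl.
      -- destruct (Ftot A B HA HB) as [H|H];
           [exists B|exists A]; eauto using tree_over_sub.
      -- exists A; split; [auto|split; [auto|]]; eapply tree_over_sub; [|eassumption]; intros x [].
      -- exists B; split; [auto|split; [|auto]]; eapply tree_over_sub; [|eassumption]; intros x [].
      -- exists (fun _ => False); auto.
- destruct (small_exists_notin A HA) as [m Hm].
  apply (Amax (fun r => A r \/ r = m)); [|now apply small_add].
  split; [intros r Hr; now left|].
  intros H; apply Hm, H; now right.
Qed.

(** * Proper subfields generated along the chain *)

Inductive gen (P : R -> Prop) : R -> Prop :=
| gen_in x : P x -> gen P x
| gen_one : gen P 1
| gen_sub x y : gen P x -> gen P y -> gen P (x - y)
| gen_mul x y : gen P x -> gen P y -> gen P (x * y)
| gen_inv x : gen P x -> gen P (/ x).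

Lemma gen_bind (P Q : R -> Prop) :
  (forall r, P r -> gen Q r) -> forall r, gen P r -> gen Q r.
Proof. intros H r Hr; induction Hr; auto using gen. Qed.

(* The leaf [Code i] in head position is an opcode: 0 is a value of [f], 1 a constant,
   2, 3 and 4 are subtraction, multiplication and inversion. *)
Fixpoint field_term (f : tree -> R) (c : nat -> R) (t : tree) : R :=
  match t with
  | Node (Code 0) s => f s
  | Node (Code 1) (Code n) => c n
  | Node (Code 2) (Node l r) => field_term f c l - field_term f c r
  | Node (Code 3) (Node l r) => field_term f c l * field_term f c r
  | Node (Code 4) s => / field_term f c s
  | _ => 1
  end.

Definition values (f : tree -> R) (A : R -> Prop) (r : R) : Prop :=
  exists t, tree_over A t /\ f t = r.

(** Each element of the field is a [field_term] of a tree over [A]. Allowing a sequence [c] is what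
    later lets independent elements be adjoined one after another. *)
Lemma gen_values_proper A f (c : nat -> R) : small A ->
  exists r, ~ gen (fun x => values f A x \/ exists n, x = c n) r.
Proof.
intros HA; destruct (HA (field_term f c)) as [r Hr].
exists r; intros G.
enough (exists t, tree_over A t /\ field_term f c t = r) as [t [Ht E]]
  by now apply (Hr t).
clear Hr; induction G as [x [[t [Ht <-]]|[n ->]]| |x y _ [s [Hs <-]] _ [t [Ht <-]]
                         |x y _ [s [Hs <-]] _ [t [Ht <-]]|x _ [s [Hs <-]]].
- exists (Node (Code 0) t); simpl; auto.
- exists (Node (Code 1) (Code n)); simpl; auto.
- exists (Code 0); simpl; auto.
- exists (Node (Code 2) (Node s t)); simpl; auto.
- exists (Node (Code 3) (Node s t)); simpl; auto.
- exists (Node (Code 4) s); simpl; auto.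
Qed.

Lemma exists_generating_chain :
  exists Phi : (R -> Prop) -> Prop,
    (forall P Q, Phi P -> Phi Q -> (forall r, P r -> Q r) \/ (forall r, Q r -> P r)) /\
    (forall r, exists P, Phi P /\ P r) /\
    (forall P (c : nat -> R), Phi P -> exists r, ~ gen (fun x => P x \/ exists n, x = c n) r).
Proof.
destruct exists_large_chain as [F [Fs [Ftot [f Hf]]]].
exists (fun P => exists A, F A /\ P = values f A).
split; [|split].
- intros P Q [A [HA ->]] [B [HB ->]].
  destruct (Ftot A B HA HB) as [H|H]; [left|right]; intros r [t [Ht <-]];
    exists t; eauto using tree_over_sub.
- intros r; destruct (Hf r) as [A [t [HA [Ht E]]]].
  exists (values f A); split; [exists A; auto|exists t; auto].
- intros P c [A [HA ->]]; now apply gen_values_proper, Fs.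
Qed.

(** * Independent elements and towers of frames *)

Definition level (P : R -> Prop) (e : nat -> R) (m : nat) : R -> Prop :=
  gen (fun x => P x \/ exists j, (j < m)%nat /\ x = e j).

Lemma level_bind P e m P' e' m' :
  (forall r, P r -> level P' e' m' r) ->
  (forall j, (j < m)%nat -> level P' e' m' (e j)) ->
  forall r, level P e m r -> level P' e' m' r.
Proof. intros HP He; apply gen_bind; intros r [Hr|[j [Hj ->]]]; [exact (HP r Hr)|exact (He j Hj)]. Qed.

Definition independent (P : R -> Prop) (e : nat -> R) (M : nat) : Prop :=
  forall m, (m < M)%nat -> 0 < e m < 1 /\ ~ level P e m (e m).

(** Field operations recover [r] from [/ (1 + Rabs r)], up to a sign that they can also change. *)
Lemma gen_unit_interval P : (exists r, ~ gen P r) -> exists r, 0 < r < 1 /\ ~ gen P r.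
Proof.
intros [r Hr].
assert (G0 : gen P 0) by (replace 0 with (1 - 1) by ring; auto using gen).
assert (Hr0 : r <> 0) by (intros ->; auto).
assert (Hpos : 0 < Rabs r) by now apply Rabs_pos_lt.
exists (/ (1 + Rabs r)); split.
- split; [apply Rinv_0_lt_compat; lra|].
  rewrite <- Rinv_1; apply Rinv_lt_contravar; lra.
- intros G; apply Hr.
  assert (Ga : gen P (Rabs r)).
  { replace (Rabs r) with (/ / (1 + Rabs r) - 1) by (field; lra); auto using gen. }
  destruct (Rcase_abs r) as [H|H].
  + rewrite Rabs_left in Ga by lra.
    replace r with (0 - - r) by ring; auto using gen.
  + now rewrite Rabs_right in Ga by lra.
Qed.

Lemma exists_independent P M :
  (forall c : nat -> R, exists r, ~ gen (fun x => P x \/ exists n, x = c n) r) ->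
  exists e, independent P e M.
Proof.
intros HP; induction M as [|M [e He]].
- exists (fun _ => 0); intros m Hm; lia.
- destruct (gen_unit_interval (fun x => P x \/ exists n, x = e n) (HP e)) as [r [Hr1 Hr]].
  (* Overwriting position [M] leaves the levels up to [M] unchanged, and [r] avoids even the field
     generated by [P] and the whole of [e]. *)
  set (e' := fun m => if Nat.eq_dec m M then r else e m).
  assert (E : forall m, (m <= M)%nat -> forall x, level P e' m x -> level P e m x).
  { intros m Hm; apply level_bind; [intros; apply gen_in; auto|].
    intros j Hj; unfold e'; destruct (Nat.eq_dec j M); [lia|].
    apply gen_in; right; exists j; auto. }
  exists e'; intros m Hm; unfold e' at 1 2 4; destruct (Nat.eq_dec m M) as [->|Hne].
  + split; [lra|]; intros G; apply Hr; apply E in G; [|lia].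
    revert G; apply gen_bind; intros x [Hx|[j [_ ->]]]; apply gen_in; eauto.
  + destruct (He m) as [He1 He2]; [lia|]; split; [lra|].
    intros G; apply He2, E; [lia|exact G].
Qed.

(* A frame [(P, e)] is a generating set of a subfield together with elements
   [e 0, ..., e (M - 1)], each one outside the field generated by [P] and its predecessors. *)
Definition frame : Type := ((R -> Prop) * (nat -> R))%type.

Definition below (M : nat) (v v' : frame) : Prop :=
  forall r, level (fst v) (snd v) M r -> level (fst v') (snd v') 0 r.

Definition tower (M : nat) (C : frame -> Prop) : Prop :=
  (forall v, C v -> independent (fst v) (snd v) M) /\
  (forall v v', C v -> C v' -> v = v' \/ below M v v' \/ below M v' v).

(** If a maximal tower missed [r], any member of [Phi] containing [r] would contain every [fst v],
    and a new frame could be placed above all the others. *)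
Lemma exists_tower M :
  exists C : frame -> Prop,
    tower M C /\ forall r, exists v, C v /\ level (fst v) (snd v) 0 r.
Proof.
destruct exists_generating_chain as [Phi [Ptot [Pcov Pext]]].
destruct (@classical_sets.Zorn_bigcup frame
  (fun C => (forall v, C v -> Phi (fst v)) /\ tower M C)) as [C [[CP [Ci Ct]] Cmax]].
- intros F HF Ftot; split; [|split].
  + intros v [X HX Xv]; now apply (HF X HX).
  + intros v [X HX Xv]; destruct (HF X HX) as [_ [H _]]; auto.
  + intros v v' [X HX Xv] [Y HY Yv].
    destruct (Ftot X Y HX HY) as [H|H];
      [destruct (HF Y HY) as [_ [_ K]]|destruct (HF X HX) as [_ [_ K]]]; auto.
- exists C; split; [split; auto|].
  intros r; apply NNPP; intros Hr.
  destruct (Pcov r) as [P0 [HP0 P0r]].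
  assert (Hsub : forall v, C v -> forall x, fst v x -> P0 x).
  { intros v Cv; destruct (Ptot (fst v) P0 (CP v Cv) HP0) as [H|H]; auto.
    exfalso; apply Hr; exists v; split; [auto|apply gen_in; auto]. }
  assert (Hfin : forall (e : nat -> R) m, exists P1, Phi P1 /\ (forall x, P0 x -> P1 x) /\
             forall j, (j < m)%nat -> P1 (e j)).
  { intros e m; induction m as [|m [P1 [HP1 [H01 H1]]]].
    - exists P0; intuition; lia.
    - destruct (Pcov (e m)) as [P2 [HP2 P2e]].
      destruct (Ptot P1 P2 HP1 HP2) as [H|H].
      + exists P2; intuition.
        destruct (Nat.eq_dec j m) as [->|]; [auto|apply H, H1; lia].
      + exists P1; intuition.
        destruct (Nat.eq_dec j m) as [->|]; [auto|apply H1; lia]. }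
  (* If [C] has a greatest frame, only its [M] elements remain to be absorbed; otherwise
     those of every frame already lie in the next one. *)
  assert (Htop : exists P1, Phi P1 /\ (forall x, P0 x -> P1 x) /\
             forall v, C v -> forall j, (j < M)%nat -> gen P1 (snd v j)).
  { destruct (classic (exists v, C v /\ forall v', C v' -> v' = v \/ below M v' v))
      as [[v [Cv Hv]]|Hno].
    - destruct (Hfin (snd v) M) as [P1 [HP1 [H01 H1]]]; exists P1; intuition.
      destruct (Hv v0 H) as [->|Hb]; [apply gen_in; auto|].
      assert (G : level (fst v) (snd v) 0 (snd v0 j)) by (apply Hb, gen_in; eauto).
      revert G; apply gen_bind; intros x [Hx|[i [Hi _]]]; [|lia].
      apply gen_in; eauto.
    - exists P0; intuition.
      apply NNPP; intros Hj; apply Hno; exists v; split; auto; intros v' Cv'.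
      destruct (Ct v' v Cv' H) as [E|[Hb|Hb]]; auto.
      exfalso; apply Hj.
      assert (G : level (fst v') (snd v') 0 (snd v j)) by (apply Hb, gen_in; eauto).
      revert G; apply gen_bind; intros x [Hx|[i [Hi _]]]; [|lia].
      apply gen_in; eauto. }
  destruct Htop as [P1 [HP1 [H01 H1]]].
  destruct (exists_independent P1 M (fun c => Pext P1 c HP1)) as [e He].
  assert (Hnew : forall v, C v -> below M v (P1, e)).
  { intros v Cv; unfold below; apply level_bind; simpl.
    - intros x Hx; apply gen_in; left; apply H01, (Hsub v Cv); auto.
    - intros j Hj; specialize (H1 v Cv j Hj); revert H1; apply gen_bind.
      intros x Hx; apply gen_in; auto. }
  apply (Cmax (fun v => C v \/ v = (P1, e))).
  + split; [intros v Hv; now left|].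
    intros H; apply Hr; exists (P1, e); split; [apply H; now right|].
    apply gen_in; left; simpl; auto.
  + split; [|split].
    * intros v [Cv| ->]; auto.
    * intros v [Cv| ->]; auto.
    * intros v v' [Cv| ->] [Cv'| ->]; auto.
Qed.

(** * Viewer systems *)

Record subfield (S : R -> Prop) : Prop := {
  subfield_one : S 1;
  subfield_sub x y : S x -> S y -> S (x - y);
  subfield_mul x y : S x -> S y -> S (x * y);
  subfield_inv x : S x -> S (/ x) }.

Lemma gen_subfield P : subfield (gen P).
Proof. split; auto using gen. Qed.

Lemma subfield_INR S j : subfield S -> S (INR j).
Proof.
intros HS; assert (H0 : S 0) by (replace 0 with (1 - 1) by ring; now apply HS; apply HS).
induction j as [|j IH]; [exact H0|].
rewrite S_INR; replace (INR j + 1) with (INR j - (0 - 1)) by ring.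
destruct HS; auto.
Qed.

Definition over (S : R -> Prop) (p : point) : Prop := S (fst p) /\ S (snd p).

(** [base], [eye] and [gap] are the [S_v], [x_v] and [t_v] announced at the outset; [full] is a
    field containing [S_v(x_v)]. *)
Record viewer_system (n : nat) : Type := {
  viewer : Type;
  class : viewer -> nat;
  base : viewer -> R -> Prop;
  full : viewer -> R -> Prop;
  eye : viewer -> point;
  gap : viewer -> R;
  class_lt v : (class v < n)%nat;
  base_subfield v : subfield (base v);
  full_subfield v : subfield (full v);
  base_full v x : base v x -> full v x;
  eye_full v : over (full v) (eye v);
  eye_generic v a b c : base v a -> base v b -> base v c ->
    a * fst (eye v) + b * snd (eye v) = c -> a = 0 /\ b = 0;
  gap_range v : 0 < gap v < 1;
  gap_fresh v : ~ full v (gap v);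
  before (v v' : viewer) : Prop := (forall x, full v x -> base v' x) /\ base v' (gap v);
  before_total v v' : v = v' \/ before v v' \/ before v' v;
  class_cofinal i l : (i < n)%nat ->
    exists v, class v = i /\ forall x, In x l -> base v x }.

Arguments class {n _} _.
Arguments base {n _} _ _.
Arguments full {n _} _ _.
Arguments eye {n _} _.
Arguments gap {n _} _.
Arguments before {n _} _ _.

Lemma tower_cofinal M C l : tower M C ->
  (forall r, exists v, C v /\ level (fst v) (snd v) 0 r) ->
  exists v, C v /\ forall r, In r l -> level (fst v) (snd v) 0 r.
Proof.
intros [_ Ht] Hcov; induction l as [|x l [v [Cv Hv]]].
- destruct (Hcov 0) as [v [Cv _]]; exists v; split; [auto|intros r []].
- destruct (Hcov x) as [v' [Cv' Hv']].
  assert (Hup : forall f r, level (fst f) (snd f) 0 r -> level (fst f) (snd f) M r).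
  { intros f; apply level_bind; [intros; apply gen_in; auto|intros; lia]. }
  destruct (Ht v v' Cv Cv') as [<-|[H|H]].
  + exists v; split; [auto|]; intros r [<-|Hr]; auto.
  + exists v'; split; [auto|]; intros r [<-|Hr]; auto.
  + exists v; split; [auto|]; intros r [<-|Hr]; auto.
Qed.

Lemma level_mono P e m m' r : (m <= m')%nat -> level P e m r -> level P e m' r.
Proof.
intros Hm; apply level_bind; intros; apply gen_in; auto.
right; exists j; split; [lia|auto].
Qed.

Lemma level_self P e m m' : (m < m')%nat -> level P e m' (e m).
Proof. intros Hm; apply gen_in; right; eauto. Qed.

(** If [b] is nonzero, the equation expresses [e (m + 1)] in the field of its predecessors; if only
    [a] is, it does the same for [e m]. *)
Lemma independent_generic P e m M a b c : independent P e M -> (m + 1 < M)%nat ->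
  level P e m a -> level P e m b -> level P e m c ->
  a * e m + b * e (m + 1)%nat = c -> a = 0 /\ b = 0.
Proof.
intros He Hm Ha Hb Hc E.
assert (Hu : level P e (m + 1) (e m)) by (apply level_self; lia).
assert (Hup : forall r, level P e m r -> level P e (m + 1) r)
  by (intros r; apply level_mono; lia).
assert (b = 0) as ->.
{ apply NNPP; intros Hb0; apply (proj2 (He (m + 1)%nat Hm)).
  replace (e (m + 1)%nat) with ((c - a * e m) * / b) by (rewrite <- E; field; auto).
  unfold level in *; auto using gen. }
split; [|reflexivity].
apply NNPP; intros Ha0; apply (proj2 (He m ltac:(lia))).
replace (e m) with (c * / a) by (rewrite <- E; field; auto).
unfold level in *; auto using gen.
Qed.

(* Each frame of a tower of height [3 n] provides one viewer of each class, from three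
   consecutive elements: two coordinates and the gap. *)
Lemma exists_viewer_system n : inhabited (viewer_system n).
Proof.
destruct (exists_tower (3 * n)) as [C [HC Hcov]].
pose (V := {fi : frame * nat | C (fst fi) /\ (snd fi < n)%nat}).
pose (cls := fun v : V => snd (proj1_sig v)).
pose (elt := fun v : V => snd (fst (proj1_sig v))).
pose (lev := fun v : V => level (fst (fst (proj1_sig v))) (elt v)).
assert (Hcls : forall v, (cls v < n)%nat) by (intros [? []]; auto).
assert (Hind : forall v : V, independent (fst (fst (proj1_sig v))) (elt v) (3 * n))
  by (intros [? []]; now apply (proj1 HC)).
assert (Hlast : forall v, (3 * cls v + 2 < 3 * n)%nat) by (intros v; specialize (Hcls v); lia).
constructor.
refine {|
  viewer := V;
  class := cls;
  base v := lev v (3 * cls v)%nat;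
  full v := lev v (3 * cls v + 2)%nat;
  eye v := (elt v (3 * cls v)%nat, elt v (3 * cls v + 1)%nat);
  gap v := elt v (3 * cls v + 2)%nat |}.
- exact Hcls.
- intros v; apply gen_subfield.
- intros v; apply gen_subfield.
- intros v x; apply level_mono; lia.
- intros v; split; apply level_self; simpl; lia.
- intros v a b c Ha Hb Hc.
  apply (independent_generic _ _ _ _ _ _ _ (Hind v)); auto.
  specialize (Hlast v); lia.
- intros v; apply (Hind v), Hlast.
- intros v; apply (Hind v), Hlast.
(* Viewers of the same frame are ordered by class, others by their frames. *)
- intros [[f i] [Hf Hi]] [[f' i'] [Hf' Hi']]; unfold lev, elt, cls; simpl in *.
  destruct (proj2 HC f f' Hf Hf') as [<-|[H|H]].
  + destruct (lt_eq_lt_dec i i') as [[Hlt| <-]|Hlt].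
    * right; left; split; [intros x; apply level_mono; lia|apply level_self; lia].
    * left; f_equal; apply Classical_Prop.proof_irrelevance.
    * right; right; split; [intros x; apply level_mono; lia|apply level_self; lia].
  + right; left; split; [intros x Hx|]; apply (level_mono _ _ 0); try lia; apply H.
    * revert Hx; apply level_mono; lia.
    * apply level_self; lia.
  + right; right; split; [intros x Hx|]; apply (level_mono _ _ 0); try lia; apply H.
    * revert Hx; apply level_mono; lia.
    * apply level_self; lia.
- intros i l Hi; destruct (tower_cofinal _ C l HC Hcov) as [f [Cf Hf]].
  exists (exist _ (f, i) (conj Cf Hi)); split; [reflexivity|].
  intros x Hx; apply (level_mono _ _ 0); [lia|exact (Hf x Hx)].
Qed.

(** * Plane geometry over a subfield *)

Definition cross (p q : point) : R := fst p * snd q - snd p * fst q.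

Definition diff (p q : point) : point := (fst p - fst q, snd p - snd q).

Lemma diff_zero p q : diff p q = (0, 0) -> p = q.
Proof. intros E; injection E; destruct p, q; simpl; intros; f_equal; lra. Qed.

Lemma cross_trans p q r : p <> (0, 0) -> cross p q = 0 -> cross p r = 0 -> cross q r = 0.
Proof.
destruct p as [p1 p2], q as [q1 q2], r as [r1 r2]; unfold cross; simpl.
intros Hp Hq Hr.
destruct (Req_dec p1 0) as [H1|H1].
- assert (H2 : p2 <> 0) by (intros ->; apply Hp; f_equal; auto).
  apply (Rmult_eq_reg_l p2); [|auto].
  replace (p2 * (q1 * r2 - q2 * r1)) with (q2 * (p1 * r2 - p2 * r1) - r2 * (p1 * q2 - p2 * q1)) by ring.
  rewrite Hq, Hr; ring.
- apply (Rmult_eq_reg_l p1); [|auto].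
  replace (p1 * (q1 * r2 - q2 * r1)) with (q1 * (p1 * r2 - p2 * r1) - r1 * (p1 * q2 - p2 * q1)) by ring.
  rewrite Hq, Hr; ring.
Qed.

(** Cramer's rule for two nonparallel lines over [S], with right-hand sides [c] and [c']. *)
Lemma over_line_meet S a d b f z : subfield S ->
  over S a -> over S d -> over S b -> over S f ->
  cross d (diff z a) = 0 -> cross f (diff z b) = 0 -> cross d f <> 0 -> over S z.
Proof.
destruct a as [a1 a2], d as [d1 d2], b as [b1 b2], f as [f1 f2], z as [z1 z2].
unfold over, cross, diff; simpl; intros [S1 Ssub Smul Sinv] [A1 A2] [D1 D2] [B1 B2] [F1 F2] E1 E2 HD.
set (c := d1 * a2 - d2 * a1); set (c' := f1 * b2 - f2 * b1).
assert (Ec : c = d1 * z2 - d2 * z1) by (unfold c; lra).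
assert (Ec' : c' = f1 * z2 - f2 * z1) by (unfold c'; lra).
assert (Sc : S c) by (unfold c; auto).
assert (Sc' : S c') by (unfold c'; auto).
split.
- replace z1 with ((f1 * c - d1 * c') * / (d1 * f2 - d2 * f1))
    by (rewrite Ec, Ec'; field; auto).
  auto 7.
- replace z2 with ((f2 * c - d2 * c') * / (d1 * f2 - d2 * f1))
    by (rewrite Ec, Ec'; field; auto).
  auto 7.
Qed.

Lemma over_diff S p q : subfield S -> over S p -> over S q -> over S (diff p q).
Proof. intros HS [] []; split; simpl; now apply HS. Qed.

Definition apex (j : nat) : point := (INR j, 0).

Lemma apex_inj i j : apex i = apex j -> i = j.
Proof. intros E; injection E; apply INR_eq. Qed.

Lemma over_apex S j : subfield S -> over S (apex j).
Proof. intros HS; split; [apply (subfield_INR S j HS)|apply (subfield_INR S 0 HS)]. Qed.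

Lemma exists_apex_avoiding N (p : nat -> point) :
  exists i, (i < S N)%nat /\ forall m, (m < N)%nat -> p m <> apex i.
Proof.
apply NNPP; intros Hno.
assert (Hincl : incl (map apex (seq 0 (S N))) (map p (seq 0 N))).
{ intros x Hx; apply in_map_iff in Hx; destruct Hx as [i [<- Hi]]; apply in_seq in Hi.
  apply NNPP; intros Hi'; apply Hno; exists i; split; [lia|].
  intros m Hm E; apply Hi'; rewrite <- E; apply in_map, in_seq; lia. }
apply NoDup_incl_length in Hincl.
- rewrite !length_map, !length_seq in Hincl; lia.
- apply Injective_map_NoDup; [exact apex_inj|apply seq_NoDup].
Qed.

(** * The web and what its apexes see *)

Section Visibility.
Context {n : nat} (Sigma : viewer_system n).
Implicit Types v : viewer n Sigma.

Inductive web : point -> Prop :=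
| web_apex j : (j < n)%nat -> web (apex j)
| web_ray p v z : web p -> over (base v) p -> p <> apex (class v) ->
    in_segment p (eye v) z -> web z.

(** Collinearity is a linear equation on the eye over the base, whose coefficients are the
    coordinates of [diff q p] up to order and sign; genericity makes them vanish. *)
Lemma eye_off_line v p q : over (base v) p -> over (base v) q ->
  cross (diff q p) (diff (eye v) p) = 0 -> q = p.
Proof.
intros Hp Hq E; pose proof (base_subfield _ _ v) as HS.
pose proof (over_diff _ _ _ HS Hq Hp) as [D1 D2].
destruct (eye_generic _ _ v (0 - snd (diff q p)) (fst (diff q p))
            (fst (diff q p) * snd p - snd (diff q p) * fst p)) as [H1 H2].
- apply HS; [apply (subfield_INR _ 0 HS)|auto].
- auto.
- destruct Hp; apply HS; apply HS; auto.
- unfold cross, diff in *; simpl in *; lra.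
- apply diff_zero; destruct (diff q p); simpl in *; f_equal; lra.
Qed.

(** The eye trivially lies on its line to each apex, so [eye_off_line] would identify it with two
    distinct ones. *)
Lemma eye_not_over v : ~ over (base v) (eye v).
Proof.
intros H; pose proof (base_subfield _ _ v) as HS.
assert (E : forall j, eye v = apex j)
  by (intros j; apply (eye_off_line v); auto using over_apex; unfold cross; ring).
pose proof (E O) as E0; rewrite (E 1%nat) in E0; apply apex_inj in E0; discriminate.
Qed.

Lemma before_trans v v' v'' : before v v' -> before v' v'' -> before v v''.
Proof.
intros [H1 H2] [H3 H4]; split; auto using base_full.
Qed.

(* The witness [w] is new over [full v] but old for every later viewer, so only a viewer
   up to [v] can have put it in the web, and then on a line over [full v]; that line must
   be the one through [z] and the apex, as otherwise [w] would be over [full v]. *)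
Lemma apex_sees_only_eye_lines j z : (j < n)%nat -> z <> apex j ->
  (forall w, in_segment z (apex j) w -> web w) ->
  exists v, class v <> j /\ cross (diff (eye v) (apex j)) (diff z (apex j)) = 0.
Proof.
intros Hj Hz Hseg; set (a := apex j) in *.
destruct (class_cofinal _ Sigma j (fst z :: snd z :: nil) Hj) as [v [_ Hv]].
assert (Hzv : over (base v) z) by (split; apply Hv; simpl; auto).
clear Hv; pose proof (gap_range _ _ v) as Ht; pose proof (gap_fresh _ _ v) as Hfresh.
set (t := gap v) in *.
set (w := ((1 - t) * fst z + t * fst a, (1 - t) * snd z + t * snd a)).
assert (Hw : web w) by (apply Hseg; exists t; split; [lra|reflexivity]).
assert (Ha : forall S, subfield S -> over S a) by (intros; now apply over_apex).
assert (Hw_new : ~ over (full v) w).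
{ intros [W1 W2]; pose proof (full_subfield _ _ v) as HS.
  destruct (Ha _ HS) as [A1 A2], Hzv as [Z1 Z2].
  apply base_full in Z1; apply base_full in Z2; simpl in W1, W2; apply Hfresh.
  destruct (Req_dec (fst a) (fst z)) as [E1|E1].
  - assert (E2 : snd a <> snd z) by (intros E2; apply Hz, diff_zero; unfold diff; f_equal; lra).
    replace t with (((1 - t) * snd z + t * snd a - snd z) * / (snd a - snd z)) by (field; lra).
    destruct HS; auto 7.
  - replace t with (((1 - t) * fst z + t * fst a - fst z) * / (fst a - fst z)) by (field; lra).
    destruct HS; auto 7. }
assert (Hw_old : forall v', before v v' -> over (base v') w).
{ intros v' [H1 H2]; pose proof (base_subfield _ _ v') as HS.
  destruct (Ha _ HS) as [A1 A2], Hzv as [Z1 Z2].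
  assert (Z1' : base v' (fst z)) by (apply H1, base_full; auto).
  assert (Z2' : base v' (snd z)) by (apply H1, base_full; auto).
  fold t in H2; unfold w; split; simpl;
    match goal with |- base v' (?x + ?y) => replace (x + y) with (x - (0 - y)) by ring end;
    pose proof (subfield_INR _ 0 HS) as H0; simpl in H0;
    destruct HS; auto 8. }
assert (Haw : cross (diff z a) (diff w a) = 0) by (unfold cross, diff, w; simpl; ring).
remember w as w' eqn:Ew in Hw.
induction Hw as [i Hi|p v' w' Hp IH Hpv' Hpc Hpw].
- exfalso; apply Hw_new; rewrite <- Ew; now apply over_apex, full_subfield.
(* A ray contains its own origin; if [w] is that origin, the earlier derivation of [p] takes
   over. *)
- subst w'; destruct (classic (p = w)) as [E|Hne]; [now apply IH|clear IH Hp].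
  destruct Hpw as [s [_ Es]].
  assert (Epw : diff w p = (s * fst (diff (eye v') p), s * snd (diff (eye v') p)))
    by (rewrite Es; unfold diff; simpl; f_equal; ring).
  destruct (classic (before v v')) as [Hb|Hb].
  (* A later viewer has [p] and [w] over its base and its eye on their line. *)
  + exfalso; apply Hne; symmetry; apply (eye_off_line v'); auto.
    rewrite Epw; unfold cross; simpl; ring.
  + assert (Hdown : over (full v) p /\ over (full v) (eye v')).
    { destruct (before_total _ _ v v') as [<-|[H|[H _]]]; [|tauto|].
      - split; [destruct Hpv'; split; now apply base_full|apply eye_full].
      - pose proof (eye_full _ _ v') as [E1 E2]; destruct Hpv'.
        repeat split; apply base_full, H; auto using base_full. }
    destruct Hdown as [Hpv Hev].
    pose proof (full_subfield _ _ v) as HS.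
    assert (Hzv' : over (full v) z) by (destruct Hzv; split; now apply base_full).
    assert (Hpar : cross (diff z a) (diff (eye v') p) = 0).
    { apply NNPP; intros HD; apply Hw_new.
      apply (over_line_meet _ a (diff z a) p (diff (eye v') p)); auto using over_diff.
      rewrite Epw; unfold cross; simpl; ring. }
    (* The ray lies on the line of [z] and [a], so [a] and [p], both over the base of [v'], are
       collinear with its eye. *)
    assert (Eap : a = p).
    { apply (eye_off_line v'); auto using base_subfield.
      replace (diff a p) with (fst (diff w p) - (1 - t) * fst (diff z a),
                               snd (diff w p) - (1 - t) * snd (diff z a))
        by (unfold diff, w; simpl; f_equal; ring).
      rewrite Epw; unfold cross in *; simpl.
      transitivity (- (1 - t) * (fst (diff z a) * snd (diff (eye v') p)
                                - snd (diff z a) * fst (diff (eye v') p)));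
        [simpl; ring|rewrite Hpar; ring]. }
    exists v'; split; [intros Hc; apply Hpc; rewrite Hc; now symmetry|].
    rewrite Eap in Hpar |- *; unfold cross in *; lra.
Qed.

(** * Lines joining eyes to apexes *)

Lemma eye_line_meets_base v j z : over (base v) z -> z <> apex j ->
  cross (diff (eye v) (apex j)) (diff z (apex j)) <> 0.
Proof.
intros Hz Hne E; apply Hne, (eye_off_line v); auto using over_apex, base_subfield.
unfold cross in *; lra.
Qed.

Lemma eye_neq_apex v j : eye v <> apex j.
Proof. intros E; apply (eye_not_over v); rewrite E; apply over_apex, base_subfield. Qed.

Lemma eye_lines_transverse v i j : i <> j ->
  cross (diff (eye v) (apex i)) (diff (apex j) (apex i)) <> 0.
Proof.
intros Hij; apply eye_line_meets_base; [apply over_apex, base_subfield|].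
intros E; now apply Hij, apex_inj.
Qed.

Lemma eye_lines_meet_same v i j z : i <> j ->
  cross (diff (eye v) (apex i)) (diff z (apex i)) = 0 ->
  cross (diff (eye v) (apex j)) (diff z (apex j)) = 0 -> z = eye v.
Proof.
intros Hij Ei Ej; apply NNPP; intros Hne.
apply (eye_lines_transverse v i j Hij).
assert (H : cross (diff (eye v) (apex i)) (diff (eye v) (apex j)) = 0).
{ apply (cross_trans (diff z (eye v))).
  - intros E; now apply Hne, diff_zero.
  - unfold cross, diff in *; simpl in *; lra.
  - unfold cross, diff in *; simpl in *; lra. }
unfold cross, diff in *; simpl in *; lra.
Qed.

(** If the two lines were parallel, sharing [z] they would coincide, and the line from [eye v] to
    [apex i] would pass through [apex j]. *)
Lemma eye_lines_meet_over v v' i j z S : i <> j -> subfield S ->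
  over S (eye v) -> over S (eye v') ->
  cross (diff (eye v) (apex i)) (diff z (apex i)) = 0 ->
  cross (diff (eye v') (apex j)) (diff z (apex j)) = 0 -> over S z.
Proof.
intros Hij HS Hv Hv' Ei Ej.
apply (over_line_meet _ (apex i) (diff (eye v) (apex i)) (apex j) (diff (eye v') (apex j)));
  auto using over_apex, over_diff.
intros Hpar; apply (eye_lines_transverse v i j Hij).
assert (H : cross (diff (eye v) (apex i)) (diff z (apex j)) = 0).
{ apply (cross_trans (diff (eye v') (apex j))); auto.
  - intros E; now apply (eye_neq_apex v' j), diff_zero.
  - unfold cross in *; lra. }
unfold cross, diff in *; simpl in *; lra.
Qed.

Lemma before_over v v' : before v v' -> over (base v') (eye v).
Proof. intros [H _]; destruct (eye_full _ _ v); split; auto. Qed.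

(** The earlier eye is over the base of the later viewer, whose line to an apex contains no such
    point but that apex. *)
Lemma eye_not_on_other_line v v' j : v <> v' ->
  cross (diff (eye v') (apex j)) (diff (eye v) (apex j)) <> 0.
Proof.
intros Hne E; destruct (before_total _ _ v v') as [?|[H|H]]; [auto| |].
- revert E; apply eye_line_meets_base; [now apply before_over|apply eye_neq_apex].
- assert (E' : cross (diff (eye v) (apex j)) (diff (eye v') (apex j)) = 0)
    by (unfold cross in *; lra).
  revert E'; apply eye_line_meets_base; [now apply before_over|apply eye_neq_apex].
Qed.

(** The first two lines meet over the base of the later [v3], so the third line misses their meeting
    point. *)
Lemma three_eye_lines v1 v2 v3 i j l z : i <> j -> before v1 v3 -> before v2 v3 ->
  z <> apex l ->
  cross (diff (eye v1) (apex i)) (diff z (apex i)) = 0 ->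
  cross (diff (eye v2) (apex j)) (diff z (apex j)) = 0 ->
  cross (diff (eye v3) (apex l)) (diff z (apex l)) <> 0.
Proof.
intros Hij H1 H2 Hz E1 E2; apply eye_line_meets_base; auto.
apply (eye_lines_meet_over v1 v2 i j); auto using base_subfield, before_over.
Qed.

(** * Seeing all apexes, and seeing fewer points *)

Lemma no_point_sees_all_apexes z : (3 <= n)%nat ->
  exists j, (j < n)%nat /\ ~ forall w, in_segment z (apex j) w -> web w.
Proof.
intros Hn; apply NNPP; intros Hno.
assert (Hsee : forall j, (j < n)%nat -> forall w, in_segment z (apex j) w -> web w)
  by (intros j Hj; apply NNPP; intros H; apply Hno; eauto).
clear Hno; destruct (classic (exists l, z = apex l)) as [[l ->]|Hz].
- assert (exists j, (j < n)%nat /\ j <> l) as [j [Hj Hjl]]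
    by (destruct l; [exists 1%nat|exists O]; split; lia).
  assert (Hlj : apex l <> apex j) by (intros E; now apply Hjl, eq_sym, apex_inj).
  destruct (apex_sees_only_eye_lines j (apex l) Hj Hlj (Hsee j Hj)) as [v [_ E]].
  revert E; now apply eye_lines_transverse.
- assert (Hz' : forall j, z <> apex j) by eauto.
  assert (HL : forall j, (j < n)%nat -> exists v, class v <> j /\
             cross (diff (eye v) (apex j)) (diff z (apex j)) = 0)
    by (intros j Hj; apply apex_sees_only_eye_lines; [| |apply Hsee]; auto).
  destruct (HL O) as [v0 [C0 E0]]; [lia|].
  (* Choosing the apex of the class of [v0] forces [v1] to differ from [v0]. *)
  destruct (HL (class v0) (class_lt _ _ v0)) as [v1 [C1 E1]].
  assert (exists l, (l < n)%nat /\ l <> O /\ l <> class v0) as [l [Hl [Hl0 Hl1]]]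
    by (destruct (Nat.eq_dec (class v0) 1); [exists 2%nat|exists 1%nat]; repeat split; lia).
  destruct (HL l Hl) as [v2 [_ E2]]; clear HL.
  set (i := class v0) in *.
  assert (H01 : v0 <> v1) by (intros <-; now apply C1).
  (* A viewer serving two apexes has its eye at [z], but no other viewer's line to an apex passes
     through that eye. *)
  destruct (classic (v2 = v0)) as [->|H02].
  { pose proof (eye_lines_meet_same _ _ _ _ Hl0 E2 E0) as ->.
    now apply (eye_not_on_other_line v0 v1 i). }
  destruct (classic (v2 = v1)) as [->|H12].
  { pose proof (eye_lines_meet_same _ _ _ _ Hl1 E2 E1) as ->.
    apply (eye_not_on_other_line v1 v0 O); auto. }
  (* The three viewers are now distinct, so one of them is the latest. *)
  assert (Habs : (before v1 v0 /\ before v2 v0) \/ (before v0 v1 /\ before v2 v1) \/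
            (before v0 v2 /\ before v1 v2)).
  { pose proof (before_trans v0 v1 v2); pose proof (before_trans v1 v0 v2).
    pose proof (before_total _ _ v0 v1) as [|]; [tauto|].
    pose proof (before_total _ _ v2 v0) as [|]; [tauto|].
    pose proof (before_total _ _ v2 v1) as [|]; [tauto|].
    tauto. }
  destruct Habs as [[]|[[]|[]]].
  + apply (three_eye_lines v1 v2 v0 i l O z); auto.
  + apply (three_eye_lines v0 v2 v1 O l i z); auto.
  + apply (three_eye_lines v0 v1 v2 O i l z); auto.
Qed.

Lemma fewer_points_have_viewer N (p : nat -> point) : n = S N -> (0 < N)%nat ->
  (forall m, (m < N)%nat -> web (p m)) ->
  exists x, web x /\ forall m, (m < N)%nat -> sees_through web x (p m).
Proof.
intros En HN Hp.
destruct (exists_apex_avoiding N p) as [i [Hi Hpi]].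
destruct (class_cofinal _ Sigma i (map (fun m => fst (p m)) (seq 0 N) ++
            map (fun m => snd (p m)) (seq 0 N))) as [v [Cv Hv]]; [lia|].
assert (Hray : forall m, (m < N)%nat -> forall z, in_segment (p m) (eye v) z -> web z).
{ intros m Hm z Hz; apply (web_ray (p m) v z); auto.
  - split; apply Hv, in_or_app; [left|right].
    + apply (in_map (fun m => fst (p m))), in_seq; lia.
    + apply (in_map (fun m => snd (p m))), in_seq; lia.
  - rewrite Cv; auto. }
(* As [N] is positive, some ray ends at the eye. *)
assert (Heye : web (eye v)).
{ apply (Hray O HN); exists 1; split; [lra|].
  destruct (eye v); simpl; f_equal; ring. }
exists (eye v); split; [auto|]; intros m Hm; split; [auto|split; [auto|]].
intros z [t [Ht ->]]; apply (Hray m Hm).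
exists (1 - t); split; [lra|f_equal; ring].
Qed.

End Visibility.

Theorem theorem1p4 :
  forall k : nat, (2 <= k)%nat ->
  exists T : point -> Prop,
    (forall p : nat -> point,
        (forall i, (i < 2 * k + 3)%nat -> T (p i)) ->
        exists x, T x /\ forall i, (i < 2 * k + 3)%nat -> sees_through T x (p i))
    /\
    (exists p : nat -> point,
        (forall i, (i < 2 * k + 4)%nat -> T (p i)) /\
        (forall i j, (i < 2 * k + 4)%nat -> (j < 2 * k + 4)%nat -> p i = p j -> i = j) /\
        ~ (exists x, T x /\ forall i, (i < 2 * k + 4)%nat -> sees_through T x (p i))).
Proof.
intros k _.
destruct (exists_viewer_system (2 * k + 4)) as [Sigma].
exists (web Sigma); split.
- intros p; apply fewer_points_have_viewer; lia.
- exists apex; split; [|split].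
  + intros i; apply web_apex.
  + intros i j _ _; apply apex_inj.
  + intros [x [_ Hx]].
    destruct (no_point_sees_all_apexes Sigma x) as [j [Hj Hsee]]; [lia|].
    apply Hsee, (Hx j Hj).
Qed.
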